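(* Let $X$ and $Y$ be the first-hop and second-hop SNRs of the selected relay (independent, with the distributions given in the context), let $\zeta\ge 1$ be a constant, and let the end-to-end SNDR of variable gain relaying (version II) be $$\gamma=\frac{XY}{\zeta Y+X+\zeta}.$$ Then for every $\gamma_{\rm th}>0$ the outage probability $P_{\rm out}(\gamma_{\rm th})=\Pr[\gamma<\gamma_{\rm th}]$ equals $$P_{\rm out}(\gamma_{\rm th})=1-\frac{2k^2}{\bar\gamma_1}\binom{N}{k}^2\sum_{m=0}^{k-1}\sum_{n=0}^{k-1}\sum_{i=1}^{2}\sum_{j=1}^{2}S_mP_nT_{m,i}Q_{n,j}\sqrt{\frac{U_{m,i}\zeta\gamma_{\rm th}(1+\gamma_{\rm th})}{R_{n,j}}}\,\exp\!\left[-\frac{\gamma_{\rm th}}{\bar\gamma_1}\left(U_{m,i}+\zeta R_{n,j}\right)\right]K_1\!\left(\frac{2}{\bar\gamma_1}\sqrt{U_{m,i}R_{n,j}\zeta\gamma_{\rm th}(1+\gamma_{\rm th})}\right),$$ where $K_1$ is the modified Bessel function of the second kind of order $1$.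
   Context: Integers $1\le k\le N$ ($N$ relays, the relay of rank $k$ is selected), average SNRs $\bar\gamma_1,\bar\gamma_2>0$, correlation coefficients $\rho_1,\rho_2\in[0,1]$, and $\bar\gamma=\bar\gamma_1\bar\gamma_2/(\bar\gamma_1+\bar\gamma_2)$. For $0\le n,m\le k-1$ set $$P_n=\frac{(-1)^n\binom{k-1}{n}}{1+\frac{\bar\gamma_2}{\bar\gamma}(N-k+n)},\qquad S_m=\frac{(-1)^m\binom{k-1}{m}}{1+\frac{\bar\gamma_1}{\bar\gamma}(N-k+m)},$$ $$Q_{n,1}=1,\quad Q_{n,2}=\frac{(N-k+n)\bar\gamma_2}{\rho_1\bar\gamma+(1-\rho_1)(N-k+n+1)\bar\gamma_1},\qquad R_{n,1}=1,\quad R_{n,2}=\frac{(N-k+n+1)\bar\gamma_1}{\rho_1\bar\gamma+(1-\rho_1)(N-k+n+1)\bar\gamma_1},$$ $$T_{m,1}=1,\quad T_{m,2}=\frac{(N-k+m)\bar\gamma_1}{(N-k+m+1)\bar\gamma_2},\qquad U_{m,1}=\frac{\bar\gamma_1}{\bar\gamma_2},\quad U_{m,2}=\frac{(N-k+m+1)\bar\gamma_1}{\rho_2\bar\gamma+(1-\rho_2)(N-k+m+1)\bar\gamma_2}.$$ $X$ and $Y$ are independent nonnegative random variables; $X$ has density, for $x\ge 0$, $$f_X(x)=\frac{k}{\bar\gamma_1}\binom{N}{k}\sum_{n=0}^{k-1}\sum_{j=1}^{2}P_nQ_{n,j}\exp\!\left(-\frac{R_{n,j}x}{\bar\gamma_1}\right),$$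 and $Y$ has CDF, for $x\ge 0$, $$F_Y(x)=1-k\binom{N}{k}\sum_{m=0}^{k-1}\sum_{i=1}^{2}S_mT_{m,i}\exp\!\left(-\frac{U_{m,i}x}{\bar\gamma_1}\right).$$ *)

(* Defs.v *)
From mathcomp Require Import all_boot all_order all_algebra.
From mathcomp Require Import all_classical all_reals all_analysis.
Set Implicit Arguments.
Unset Strict Implicit.
Unset Printing Implicit Defensive.
Import Order.TTheory GRing.Theory Num.Theory.
Import numFieldNormedType.Exports.
Local Open Scope classical_set_scope.
Local Open Scope ring_scope.

Definition coshR (R : realType) (t : R) : R := (expR t + expR (- t)) / 2.

(* Modified Bessel function of the second kind of real order nu, by the
   integral formula (Gradshteyn-Ryzhik 8.432.1, DLMF 10.32.9)
   K_nu(x) = \int_0^oo exp (- x cosh t) cosh (nu t) dt, meaningful for x > 0. *)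
Definition besselK (R : realType) (nu x : R) : R :=
  Rintegral lebesgue_measure `[0%R, +oo[
    (fun t : R => expR (- x * coshR t) * coshR (nu * t)).

Definition independent_RV (d : measure_display) (Omega : measurableType d)
    (R : realType) (P : probability Omega R) (X Y : {RV P >-> R}) : Prop :=
  forall A B : set R, measurable A -> measurable B ->
    P (X @^-1` A `&` Y @^-1` B) = (P (X @^-1` A) * P (Y @^-1` B))%E.

Definition has_density (d : measure_display) (Omega : measurableType d)
    (R : realType) (P : probability Omega R) (X : {RV P >-> R})
    (f : R -> R) : Prop :=
  forall A : set R, measurable A ->
    distribution P X A = (\int[lebesgue_measure]_(x in A) (f x)%:E)%E.

(* g1, g2 are the average SNRs of the two hops, r1, r2 the correlation
   coefficients. Differences N - k are taken in nat, hence require k <= N.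
   The second index of Q, R, T, U ranges over {1, 2}; the value at indices
   other than 1 is the one for 2. *)

Definition gbar (R : realType) (g1 g2 : R) : R := g1 * g2 / (g1 + g2).

Definition coefP (R : realType) (N k : nat) (g1 g2 : R) (n : nat) : R :=
  (-1) ^+ n * 'C(k.-1, n)%:R / (1 + g2 / gbar g1 g2 * (N - k + n)%:R).

Definition coefS (R : realType) (N k : nat) (g1 g2 : R) (m : nat) : R :=
  (-1) ^+ m * 'C(k.-1, m)%:R / (1 + g1 / gbar g1 g2 * (N - k + m)%:R).

Definition coefQ (R : realType) (N k : nat) (g1 g2 r1 : R) (n j : nat) : R :=
  if j == 1%N then 1
  else (N - k + n)%:R * g2 /
       (r1 * gbar g1 g2 + (1 - r1) * (N - k + n + 1)%:R * g1).

Definition coefR (R : realType) (N k : nat) (g1 g2 r1 : R) (n j : nat) : R :=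
  if j == 1%N then 1
  else (N - k + n + 1)%:R * g1 /
       (r1 * gbar g1 g2 + (1 - r1) * (N - k + n + 1)%:R * g1).

Definition coefT (R : realType) (N k : nat) (g1 g2 : R) (m i : nat) : R :=
  if i == 1%N then 1
  else (N - k + m)%:R * g1 / ((N - k + m + 1)%:R * g2).

Definition coefU (R : realType) (N k : nat) (g1 g2 r2 : R) (m i : nat) : R :=
  if i == 1%N then g1 / g2
  else (N - k + m + 1)%:R * g1 /
       (r2 * gbar g1 g2 + (1 - r2) * (N - k + m + 1)%:R * g2).

Definition fX (R : realType) (N k : nat) (g1 g2 r1 : R) (x : R) : R :=
  if 0 <= x then
    k%:R / g1 * 'C(N, k)%:R *
    \sum_(0 <= n < k) \sum_(1 <= j < 3)
      coefP N k g1 g2 n * coefQ N k g1 g2 r1 n j *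
      expR (- (coefR N k g1 g2 r1 n j * x / g1))
  else 0.

(* Only meaningful for x >= 0. *)
Definition FY (R : realType) (N k : nat) (g1 g2 r2 : R) (x : R) : R :=
  1 - k%:R * 'C(N, k)%:R *
    \sum_(0 <= m < k) \sum_(1 <= i < 3)
      coefS N k g1 g2 m * coefT N k g1 g2 m i *
      expR (- (coefU N k g1 g2 r2 m i * x / g1)).

(* End-to-end SNDR of variable gain relaying (version II), as a function of
   the SNRs x and y of the two hops. *)
Definition sndr (R : realType) (zeta x y : R) : R :=
  x * y / (zeta * y + x + zeta).

(* Main.v *)
(* For nonnegative x and y, clearing the denominator turns gamma >= t into
   (x - t zeta) (y - t) >= zeta t (1 + t) with x > t zeta, so by independence
   1 - P_out is the integral over x > t zeta of f_X(x) times
   P(Y >= t + zeta t (1 + t) / (x - t zeta)). Expanding the product of the two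
   exponential sums leaves integrals of exp (- (a u + b / u)) over u > 0; the
   substitution u = sqrt (b / a) exp s, followed by folding s to - s, gives
   2 sqrt (b / a) K_1 (2 sqrt (a b)). *)
Require Import Defs.
From HB Require Import structures.
From mathcomp Require Import all_boot all_order all_algebra.
From mathcomp Require Import all_classical all_reals all_analysis.
From mathcomp Require Import measurable_realfun ring lra.
Set Implicit Arguments.
Unset Strict Implicit.
Unset Printing Implicit Defensive.
Import Order.TTheory GRing.Theory Num.Theory.
Import numFieldNormedType.Exports.
Local Open Scope classical_set_scope.
Local Open Scope ring_scope.

(** * Folding and exponential substitution for integrals of nonnegative functions *)

(** Split the line at 0 and reflect the negative half by s to -s; the endpoint 0 is negligible. *)
Lemma ge0_integral_setT_fold (R : realType) (H : R -> R) :
  (forall s, 0 <= H s) -> continuous H ->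
  (\int[lebesgue_measure]_s (H s)%:E =
   \int[lebesgue_measure]_(s in `[0%R, +oo[) (H s + H (- s))%:E)%E.
Proof.
move=> H0 cH.
have mH : measurable_fun [set: R] H by exact: continuous_measurable_fun.
rewrite -(setUv `[0%R, +oo[) ge0_integral_setU//=; last 4 first.
- exact: measurableC.
- by rewrite setUv; exact/measurable_EFinP.
- by move=> x _; rewrite lee_fin.
- exact/disj_setPCl.
under [RHS]eq_integral do rewrite EFinD.
rewrite ge0_integralD//=.
- congr (_ + _)%E; rewrite setCitvr integral_itv_bndo_bndc; last first.
    (* Once measurability is settled, the bound 0 is written as [- 0], the form in which reflection
       of a half-line at its endpoint applies. *)
    exact/measurable_funTS/measurable_EFinP.
  rewrite -[in LHS]oppr0 ge0_integration_by_substitutionNy//.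
  exact: continuous_subspaceT.
- by move=> x _; rewrite lee_fin.
- exact/measurable_funTS/measurable_EFinP.
- by move=> x _; rewrite lee_fin.
- apply/measurable_funTS/measurable_EFinP.
  apply: continuous_measurable_fun => x.
  by apply: continuous_comp; [exact: opp_continuous|exact: cH].
Qed.

(** The map [F] s = c + l exp s is an increasing bijection from the line onto the half-line above c.
    The substitution rule is used on each compact [-n, n]; since [G] is nonnegative, monotone
    convergence along these intervals and their images gives the full integrals. *)
Lemma ge0_integration_by_substitution_expR (R : realType) (c l : R)
    (G : R -> R) :
  0 < l -> {in `]c, +oo[, continuous G} -> (forall x, c < x -> 0 <= G x) ->
  (\int[lebesgue_measure]_(x in `]c, +oo[) (G x)%:E =
   \int[lebesgue_measure]_s (G (c + l * expR s) * (l * expR s))%:E)%E.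
Proof.
move=> l0 cG G0.
pose F (s : R) := c + l * expR s.
have cF s : c < F s by rewrite ltrDl mulr_gt0// expR_gt0.
have dF (s : R) : is_derive s 1 F (l * expR s).
  apply: is_derive_eq.
  by rewrite add0r mul1r.
have F'E : F^`()%classic = (fun s => l * expR s).
  by apply/funext => s; rewrite derive1E derive_val.
have ctF : continuous F.
  by move=> s; apply/differentiable_continuous/derivable1_diffP; exact: ex_derive.
have ctF' : continuous (fun s : R => l * expR s).
  move=> s; apply: cvgM; [exact: cvg_cst|exact: continuous_expR].
have ndF x y : x < y -> F x < F y.
  by move=> xy; rewrite /F ltrD2l ltr_pM2l// ltr_expR.
have ndFle x y : x <= y -> F x <= F y.
  by move=> xy; rewrite /F lerD2l ler_pM2l// ler_expR.
have E n : (\int[lebesgue_measure]_(x in `[F (- n%:R)%R, F n%:R%R]) (G x)%:E =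
   \int[lebesgue_measure]_(s in `[(- n%:R)%R, n%:R%R]) (G (F s) * (l * expR s))%:E)%E.
  rewrite integration_by_substitution_increasing.
  - by rewrite F'E; apply: eq_integral.
  - by rewrite ge0_cp.
  - by move=> x y _ _; exact: ndF.
  - by move=> x _; rewrite F'E; exact: ctF'.
  - by rewrite F'E; apply/cvg_ex; eexists; apply/cvg_at_right_filter; exact: ctF'.
  - by rewrite F'E; apply/cvg_ex; eexists; apply/cvg_at_left_filter; exact: ctF'.
  - split.
    + by move=> x _; exact: ex_derive.
    + by apply/cvg_at_right_filter; exact: ctF.
    + by apply/cvg_at_left_filter; exact: ctF.
  - apply: continuous_in_subspaceT => x; rewrite inE/= in_itv/= => /andP[Fx _].
    by apply: cG; rewrite in_itv/= andbT (lt_le_trans (cF _) Fx).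
have mG : measurable_fun `]c, +oo[ G.
  apply: open_continuous_measurable_fun; first exact: interval_open.
  by move=> x; rewrite inE => xc; exact: cG.
have cGF : continuous (fun s => G (F s) * (l * expR s)).
  move=> s; apply: cvgM; last exact: ctF'.
  apply: continuous_comp; first exact: ctF.
  by apply: cG; rewrite in_itv/= andbT.
pose D (n : nat) := [set` `[F (- n%:R), F n%:R]].
pose B (n : nat) := [set` `[- n%:R : R, n%:R]].
have DU : \bigcup_n D n = `]c, +oo[%classic.
  apply/seteqP; split => [x [n _]|x]; rewrite /D/= !in_itv/= ?andbT.
    by move=> /andP[+ _]; apply: lt_le_trans.
  (* The preimage of x under [F]; any integer n above |s| puts x in [D n]. *)
  move=> cx; pose s := ln ((x - c) / l).
  have sE : F s = x.
    rewrite /F /s lnK; last by rewrite posrE divr_gt0// subr_gt0.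
    by rewrite mulrCA divff ?gt_eqF// mulr1 addrC subrK.
  exists (Num.truncn `|s|).+1 => //=.
  have sn : `|s| <= (Num.truncn `|s|).+1%:R by exact/ltW/truncnS_gt.
  rewrite /D/= in_itv/= -sE !ndFle//.
    exact: le_trans (ler_norm _) sn.
  by rewrite lerNl (le_trans _ sn)// -normrN ler_norm.
have BU : \bigcup_n B n = setT.
  apply/seteqP; split => // s _.
  exists (Num.truncn `|s|).+1 => //=.
  have sn : `|s| <= (Num.truncn `|s|).+1%:R by exact/ltW/truncnS_gt.
  by rewrite /B/= in_itv/= -ler_norml.
have ndB : nondecreasing_seq B.
  move=> m n mn; apply/subsetPset/subset_itv; rewrite bnd_simp.
    by rewrite lerN2 ler_nat.
  by rewrite ler_nat.
have ndD : nondecreasing_seq D.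
  move=> m n mn; apply/subsetPset/subset_itv; rewrite bnd_simp ndFle//.
    by rewrite lerN2 ler_nat.
  by rewrite ler_nat.
have DL : (\int[lebesgue_measure]_(x in D n) (G x)%:E @[n --> \oo] -->
    \int[lebesgue_measure]_(x in `]c, +oo[) (G x)%:E)%E.
  rewrite -DU; apply: ge0_nondecreasing_set_cvg_integral => //=.
  - by move=> n; exact: measurable_itv.
  - move=> n; apply/measurable_EFinP; apply: measurable_funS mG => //.
    by rewrite -DU; exact: bigcup_sup.
  - move=> n x; rewrite /D/= in_itv/= => /andP[+ _].
    by move=> Fx; rewrite lee_fin G0// (lt_le_trans _ Fx).
have BL : (\int[lebesgue_measure]_(s in B n) (G (F s) * (l * expR s))%:E @[n --> \oo] -->
    \int[lebesgue_measure]_s (G (F s) * (l * expR s))%:E)%E.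
  rewrite -BU; apply: ge0_nondecreasing_set_cvg_integral => //=.
  - by move=> n; exact: measurable_itv.
  - move=> n; apply/measurable_funTS/measurable_EFinP; exact: continuous_measurable_fun.
  - move=> n x _; rewrite lee_fin mulr_ge0 ?G0//.
    by rewrite mulr_ge0 ?expR_ge0// ltW.
move: DL; rewrite [X in X @ \oo](_ : _ = fun n =>
  \int[lebesgue_measure]_(s in B n) (G (F s) * (l * expR s))%:E)%E; last first.
  by apply/funext => n; exact: E.
by move=> DL; exact: (cvg_unique (@ereal_hausdorff R) DL BL).
Qed.

(** * The integral representation of K_1 *)

(** The antiderivative -exp (- a (x - c)) / a tends to 0 at infinity. This exponential is the
    majorant that makes the Bessel-type integral finite. *)
Lemma integral_expR_shift_lty (R : realType) (a c : R) : 0 < a ->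
  (\int[lebesgue_measure]_(x in `]c, +oo[) (expR (- (a * (x - c))))%:E < +oo)%E.
Proof.
move=> a0.
have cexp : continuous (fun x : R => expR (- (a * (x - c)))).
  move=> x; apply: continuous_comp; last exact: continuous_expR.
  apply: cvgN; apply: cvgM; first exact: cvg_cst.
  by apply: cvgB; [exact: cvg_id|exact: cvg_cst].
have dexp (x : R) : is_derive x 1 (fun x => - (a^-1 * expR (- (a * (x - c)))))
    (expR (- (a * (x - c)))).
  apply: is_derive_eq.
  by rewrite subr0 /GRing.scale/=; field; rewrite gt_eqF.
rewrite integral_itv_obnd_cbnd; last first.
  by apply/measurable_funTS/measurable_EFinP; exact: continuous_measurable_fun.
rewrite (@ge0_continuous_FTC2y _ _
  (fun x => - (a^-1 * expR (- (a * (x - c))))) _ 0)//.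
- by rewrite -EFinB ltry.
- exact: continuous_subspaceT.
- rewrite -oppr0 -(mulr0 a^-1); apply: cvgN; apply: cvgM; first exact: cvg_cst.
  rewrite (_ : (fun x => expR (- (a * (x - c)))) =
    (fun y : R => expR (- y)) \o (fun x => a * (x - c)))//.
  apply: (@cvg_comp _ _ _ _ _ _ (pinfty_nbhs R)); last exact: cvgr_expR.
  by apply: gt0_cvgMry => //; exact: cvg_addrr.
- apply/cvg_at_right_filter; apply: cvgN; apply: cvgM; first exact: cvg_cst.
  exact: cexp.
- by move=> x _; rewrite derive1E derive_val.
Qed.

Lemma continuous_expR_hyperbola (R : realType) (a b c x : R) : c < x ->
  {for x, continuous (fun x => expR (- (a * (x - c) + b / (x - c))))}.
Proof.
move=> cx; apply: continuous_comp; last exact: continuous_expR.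
have cB : {for x, continuous (fun x : R => x - c)}.
  by apply: cvgB; [exact: cvg_id|exact: cvg_cst].
apply: cvgN; apply: cvgD; apply: cvgM => //; [exact: cvg_cst|exact: cvg_cst|].
by apply: cvgV => //; rewrite subr_eq0 gt_eqF.
Qed.

(** With l = sqrt (b / a) one has b = a l^2, so x = c + l exp s turns the exponent into -2 a l cosh
    s. Folding the Jacobian l exp s gives 2 l cosh s, which is the factor cosh (nu s) at nu = 1;
    moreover a l = sqrt (a b). *)
Lemma integral_expR_besselK (R : realType) (a b c : R) : 0 < a -> 0 < b ->
  (\int[lebesgue_measure]_(x in `]c, +oo[)
     (expR (- (a * (x - c) + b / (x - c))))%:E =
   (2 * Num.sqrt (b / a) * besselK 1 (2 * Num.sqrt (a * b)))%:E)%E.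
Proof.
move=> a0 b0; pose l : R := Num.sqrt (b / a); rewrite -/l.
have l0 : 0 < l by rewrite sqrtr_gt0 divr_gt0.
have bE : b = a * l ^+ 2.
  by rewrite sqr_sqrtr ?divr_ge0 ?ltW// mulrCA divff ?mulr1// gt_eqF.
have -> : Num.sqrt (a * b) = a * l.
  rewrite bE mulrA -expr2 -exprMn sqrtr_sqr ger0_norm//.
  by rewrite mulr_ge0// ltW.
pose G (x : R) := expR (- (a * (x - c) + b / (x - c))).
have cG : {in `]c, +oo[, continuous G}.
  by move=> x; rewrite in_itv/= andbT; exact: continuous_expR_hyperbola.
(* Dropping the nonnegative term b / (x - c) from the exponent leaves the exponential majorant. *)
have Gfin : (\int[lebesgue_measure]_(x in `]c, +oo[) (G x)%:E < +oo)%E.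
  apply: le_lt_trans (integral_expR_shift_lty c a0).
  apply: ge0_le_integral => //=.
  - by move=> x _; rewrite lee_fin expR_ge0.
  - apply/measurable_EFinP; apply: open_continuous_measurable_fun.
      exact: interval_open.
    by move=> x; rewrite inE => xc; exact: cG.
  - apply/measurable_funTS/measurable_EFinP.
    apply: continuous_measurable_fun => x.
    apply: continuous_comp; last exact: continuous_expR.
    apply: cvgN; apply: cvgM; first exact: cvg_cst.
    by apply: cvgB; [exact: cvg_id|exact: cvg_cst].
  - move=> x; rewrite in_itv/= andbT => cx.
    by rewrite lee_fin ler_expR lerN2 lerDl divr_ge0 ?subr_ge0// ltW.
pose f (t : R) := expR (- (2 * (a * l)) * coshR t) * coshR (1 * t).
have cosh0 (t : R) : 0 <= coshR t.
  by rewrite /coshR divr_ge0// addr_ge0 ?expR_ge0.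
have ccosh : continuous (@coshR R).
  move=> t; apply: cvgM; last exact: cvg_cst.
  apply: cvgD; first exact: continuous_expR.
  by apply: continuous_comp; [exact: opp_continuous|exact: continuous_expR].
have f0 t : 0 <= f t by rewrite mulr_ge0 ?expR_ge0.
have cf : continuous f.
  move=> t; apply: cvgM.
    apply: continuous_comp; last exact: continuous_expR.
    by apply: cvgM; [exact: cvg_cst|exact: ccosh].
  by under eq_fun do rewrite mul1r; rewrite mul1r; exact: ccosh.
have GE s : G (c + l * expR s) * (l * expR s) =
    l * (expR (- (2 * (a * l)) * coshR s) * expR s).
  rewrite /G bE addrAC subrr add0r mulrCA; congr (_ * (expR _ * _)).
  rewrite /coshR expRN.
  have : expR s != 0 by rewrite gt_eqF ?expR_gt0.
  move: (expR s) (gt_eqF l0) => e /negbT ln0 en0; field.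
  by rewrite en0 ln0.
have main : (\int[lebesgue_measure]_(x in `]c, +oo[) (G x)%:E =
    (2 * l)%:E * \int[lebesgue_measure]_(t in `[0%R, +oo[) (f t)%:E)%E.
  rewrite (ge0_integration_by_substitution_expR l0 cG); last first.
    by move=> x _; exact: expR_ge0.
  under eq_integral do rewrite GE.
  rewrite ge0_integral_setT_fold.
  - rewrite -ge0_integralZl//=.
    + apply: eq_integral => s _; congr EFin.
      rewrite /f mul1r /coshR opprK (addrC (expR (- s))); lra.
    + by apply/measurable_funTS/measurable_EFinP; exact: continuous_measurable_fun.
    + by move=> t _; rewrite lee_fin.
    + by rewrite lee_fin mulr_ge0// ltW.
  - by move=> s; rewrite !mulr_ge0 ?expR_ge0// ltW.
  - move=> s; apply: cvgM; first exact: cvg_cst.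
    apply: cvgM; last exact: continuous_expR.
    apply: continuous_comp; last exact: continuous_expR.
    by apply: cvgM; [exact: cvg_cst|exact: ccosh].
rewrite main [RHS]EFinM; congr (_ * _)%E.
(* [Rintegral] is the finite part of an extended integral, so recovering that integral requires its
   finiteness, transported from [Gfin] by solving [main] for it. *)
rewrite /besselK /Rintegral fineK// ge0_fin_numE; last first.
  by apply: integral_ge0 => t _; rewrite lee_fin; exact: f0.
have lf : (\int[lebesgue_measure]_(t in `[0%R, +oo[) (f t)%:E =
  (2 * l)^-1%:E * \int[lebesgue_measure]_(x in `]c, +oo[) (G x)%:E)%E.
  rewrite main muleA -EFinM mulVf ?mul1e//.
  by rewrite gt_eqF// mulr_gt0.
change (\int[lebesgue_measure]_(t in `[0%R, +oo[) (f t)%:E < +oo)%E.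
rewrite lf; apply: lte_mul_pinfty => //.
by rewrite lee_fin invr_ge0 mulr_ge0// ltW.
Qed.

(** * Almost sure events, independence, densities and distribution functions *)

Lemma measurable_fun_bool_set (d : measure_display) (T : measurableType d)
    (b : T -> bool) : measurable_fun setT b -> measurable [set x | b x].
Proof.
move=> mb; rewrite (_ : [set x | b x] = setT `&` b @^-1` [set true]).
  exact: mb.
by rewrite setTI; apply/seteqP; split.
Qed.

(** Each of the two sets is contained in the union of the other with a null set. *)
Lemma ae_eq_measure_set (d : measure_display) (T : measurableType d)
    (R : realType) (mu : {measure set T -> \bar R}) (U V : set T) :
  measurable U -> measurable V -> {ae mu, forall w, U w <-> V w} ->
  mu U = mu V.
Proof.
move=> mU mV [N [mN N0 UVN]].
suff le (A B : set T) : measurable A -> measurable B ->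
    ~` (fun w => A w <-> B w) `<=` N -> (mu A <= mu B)%E.
  apply/eqP; rewrite eq_le !le//.
  by move=> w nVU; apply: UVN => UV; apply: nVU; split => /UV.
move=> mA mB ABN; apply: (@le_trans _ _ (mu (B `|` N))).
  apply: le_measure; rewrite ?inE//; first exact: measurableU.
  move=> w Aw; have [Bw|nBw] := pselect (B w); first by left.
  by right; apply: ABN => AB; apply: nBw; apply/AB.
by rewrite (le_trans (measureU2 _ _ _))// [X in (_ + X)%E]N0 adde0.
Qed.

(** Independence says that the law of the pair agrees with the product of the marginal laws on
    rectangles. By uniqueness of the product measure they agree on every measurable set, and the
    product measure integrates the measures of sections. *)
Lemma independent_RV_joint (d : measure_display)
    (Omega : measurableType d) (R : realType) (P : probability Omega R)
    (X Y : {RV P >-> R}) (A : set (R * R)) :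
  independent_RV X Y -> measurable A ->
  P [set w | A (X w, Y w)] =
  (\int[P]_w distribution P Y (xsection A (X w)))%E.
Proof.
move=> XY mA.
have mXY : measurable_fun setT (fun w => (X w, Y w)).
  exact: measurable_fun_pair.
pose XYm : {mfun Omega >-> (R * R)%type} :=
  HB.pack (fun w => (X w, Y w)) (isMeasurableFun.Build _ _ _ _ _ mXY).
have joint := @product_measure_unique _ _ _ _ R (distribution P X)
  (distribution P Y) (distribution P XYm).
transitivity (\int[distribution P X]_x distribution P Y (xsection A x))%E.
  by apply/esym/joint => // B C mB mC; exact: XY.
rewrite ge0_integral_distribution//.
exact: measurable_fun_xsection.
Qed.

(** The law of X is absolutely continuous, and [f] coincides almost everywhere with its
    Radon-Nikodym derivative because both have the same integral over every measurable set. *)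
Lemma integral_has_density (d : measure_display)
    (Omega : measurableType d) (R : realType) (P : probability Omega R)
    (X : {RV P >-> R}) (f : R -> R) (g : R -> \bar R) :
  has_density X f -> measurable_fun setT f -> measurable_fun setT g ->
  P.-integrable setT (g \o X) ->
  (\int[P]_w g (X w) = \int[lebesgue_measure]_x (g x * (f x)%:E))%E.
Proof.
move=> Xf mf mg ig.
have mX : measurable_fun setT (X : Omega -> measurableTypeR R).
  exact: (measurable_funPT X).
(* [X] retyped with the display that [lebesgue_measure] lives on. *)
pose X' : {mfun Omega >-> measurableTypeR R} :=
  HB.pack (X : Omega -> measurableTypeR R) (isMeasurableFun.Build _ _ _ _ _ mX).
have dom : distribution P X' `<< lebesgue_measure.
  move=> A A0 B mB BA; rewrite [LHS]Xf// null_set_integral//.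
    exact/measurable_funTS/measurable_EFinP.
  exact: A0.
have ig' : (distribution P X').-integrable setT g.
  apply/integrableP; split => //.
  rewrite ge0_integral_distribution//.
    by case/integrableP : ig.
  exact: measurableT_comp.
transitivity (\int[distribution P X']_x g x)%E.
  by rewrite integral_distribution.
rewrite -(Radon_Nikodym_change_of_variables dom)//.
have eqf : ae_eq lebesgue_measure setT
    (Radon_Nikodym (charge_of_finite_measure (distribution P X'))
      lebesgue_measure) (EFin \o f).
  apply: integral_ae_eq => //.
  - exact: Radon_Nikodym_integrable.
  - exact/measurable_EFinP.
  - move=> A _ mA; rewrite -Radon_Nikodym_integral//=; exact: Xf.
apply: ae_eq_integral => //.
- apply: emeasurable_funM => //.
- apply: emeasurable_funM => //; exact/measurable_EFinP.
- by apply: filterS eqf => x /= fx _; rewrite fx.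
Qed.

(* The CDF gives P(Y <= y); P(Y >= y) needs its left limit. *)
Lemma distribution_cy_cdf (d : measure_display)
    (Omega : measurableType d) (R : realType) (P : probability Omega R)
    (Y : {RV P >-> R}) (F : R -> R) (y : R) :
  0 < y -> (forall z, 0 <= z -> cdf Y z = (F z)%:E) -> {for y, continuous F} ->
  distribution P Y `[y, +oo[ = (1 - F y)%:E.
Proof.
move=> y0 YF cF.
have -> : `[y, +oo[%classic = ~` `]-oo, y[%classic :> set R.
  by rewrite setCitvl.
rewrite probability_setC// EFinB; congr (1 - _)%E.
apply/eqP; rewrite eq_le; apply/andP; split.
  rewrite -YF; last exact: ltW.
  rewrite /cdf le_measure ?inE//.
  by apply: subset_itvl; rewrite bnd_simp.
rewrite -[leRHS]fineK ?fin_num_measure// lee_fin.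
(* For 0 <= z < y, F z = P(Y <= z) is at most P(Y < y); letting z increase to y gives the missing
   bound by continuity. Since y > 0, z can be kept nonnegative, where [F] is known to be the CDF. *)
have Fy : F z @[z --> y^'-] --> F y by exact: cvg_at_left_filter.
apply: (cvgr_to_le Fy); near=> z.
have z0 : 0 <= z by near: z; exact: nbhs_left_ge.
rewrite -lee_fin fineK ?fin_num_measure// -YF// /cdf le_measure ?inE//.
by apply: subset_itvl; rewrite bnd_simp/=; near: z; exact: nbhs_left_lt.
Unshelve. all: by end_near. Qed.

(** * The outage event *)

Lemma sndr_ltE (R : realType) (zeta t x y : R) :
  0 < zeta -> 0 < t -> 0 <= x -> 0 <= y ->
  (sndr zeta x y < t) =
  ~~ ((t * zeta < x) && (zeta * t * (1 + t) <= (x - t * zeta) * (y - t))).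
Proof.
move=> z0 t0 x0 y0; have D0 : 0 < zeta * y + x + zeta.
  by rewrite ltr_wpDl// addr_ge0// mulr_ge0// ltW.
rewrite /sndr ltr_pdivrMr// ltNge; congr (~~ _).
apply/idP/andP => [h|[_ h]]; last by lra.
split; last by lra.
(* If x <= t zeta, then x y <= t zeta y < t (zeta y + x + zeta), against [h]. This rules out the
   case where both factors are negative. *)
rewrite ltNge; apply/negP => xle.
have : 0 <= (t * zeta - x) * y by rewrite mulr_ge0// subr_ge0.
have : 0 < t * zeta by rewrite mulr_gt0.
have : 0 <= t * x by rewrite mulr_ge0// ltW.
by move=> ? ? ?; lra.
Qed.

Lemma measurable_sndr_lt (d : measure_display) (T : measurableType d)
    (R : realType) (X Y : {mfun T >-> R}) (zeta t : R) :
  measurable [set w | sndr zeta (X w) (Y w) < t].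
Proof.
pose D w := zeta * Y w + X w + zeta.
pose n w := X w * Y w.
have mD : measurable_fun setT D.
  apply: measurable_funD => //; apply: measurable_funD => //.
  exact: measurable_funM.
have mn : measurable_fun setT n by exact: measurable_funM.
have mtD : measurable_fun setT (fun w => t * D w) by exact: measurable_funM.
(* X and Y may take any sign here, so the quotient is cleared according to the sign of its
   denominator. Division by zero returns 0, so where [D] vanishes the condition reads 0 < t. *)
have -> : [set w | sndr zeta (X w) (Y w) < t] =
    [set w | [|| (0 < D w) && (n w < t * D w), (D w < 0) && (t * D w < n w) |
                 [&& D w <= 0, 0 <= D w & 0 < t]]].
  apply/seteqP; split=> w /=; rewrite /sndr -/(D w) -/(n w);
    case: (ltgtP (D w) 0) => [D0|D0|->] /=; rewrite ?orbF ?invr0 ?mulr0//.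
  - by rewrite ltr_ndivrMr.
  - by rewrite ltr_pdivrMr.
  - by rewrite ltr_ndivrMr.
  - by rewrite ltr_pdivrMr.
apply: measurable_fun_bool_set; apply: measurable_or; last apply: measurable_or.
- by apply: measurable_and; exact: measurable_fun_ltr.
- by apply: measurable_and; exact: measurable_fun_ltr.
- apply: measurable_and; first exact: measurable_fun_ler.
  by apply: measurable_and; [exact: measurable_fun_ler|exact: measurable_fun_ltr].
Qed.

(** * Termwise integration of finite sums *)

(** Value and integrability travel together, because the coefficients of the sums alternate in sign
    and linearity of the integral then needs integrable terms. *)
Definition has_integral (d : measure_display) (T : measurableType d)
    (R : realType) (mu : {measure set T -> \bar R}) (D : set T) (f : T -> R)
    (v : R) : Prop :=
  mu.-integrable D (EFin \o f) /\ (\int[mu]_(x in D) (f x)%:E = v%:E)%E.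

Lemma has_integralZ (d : measure_display) (T : measurableType d)
    (R : realType) (mu : {measure set T -> \bar R}) (D : set T) (f : T -> R)
    (k v : R) :
  measurable D -> has_integral mu D f v ->
  has_integral mu D (fun x => k * f x) (k * v).
Proof.
move=> mD [fi fv]; split; first exact: (integrableZl mD k fi).
under eq_integral do rewrite EFinM.
by rewrite integralZl// fv.
Qed.

Lemma has_integral_sum (d : measure_display) (T : measurableType d)
    (R : realType) (mu : {measure set T -> \bar R}) (D : set T) (I : Type)
    (s : seq I) (f : I -> T -> R) (v : I -> R) :
  measurable D -> (forall i, has_integral mu D (f i) (v i)) ->
  has_integral mu D (fun x => \sum_(i <- s) f i x) (\sum_(i <- s) v i).
Proof.
move=> mD fv; have E x : ((\sum_(i <- s) f i x)%:E = \sum_(i <- s) (f i x)%:E)%E.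
  by rewrite sumEFin.
split.
  rewrite (_ : EFin \o _ = fun x => (\sum_(i <- s) (f i x)%:E)%E); last first.
    exact/funext.
  by apply: integrable_sum => // i _; exact: (fv i).1.
under eq_integral do rewrite E.
rewrite integral_sum//; last by move=> i; exact: (fv i).1.
rewrite -sumEFin; apply: eq_bigr => i _; exact: (fv i).2.
Qed.

(** The integrand equals its absolute value, so the finite value of its integral also yields
    integrability. *)
Lemma has_integral_expR_besselK (R : realType) (a b c : R) : 0 < a -> 0 < b ->
  has_integral lebesgue_measure `]c, +oo[
    (fun x => expR (- (a * (x - c) + b / (x - c))))
    (2 * Num.sqrt (b / a) * besselK 1 (2 * Num.sqrt (a * b))).
Proof.
move=> a0 b0; have E := @integral_expR_besselK R a b c a0 b0.
split; last exact: E.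
apply/integrableP; split.
  apply/measurable_EFinP; apply: open_continuous_measurable_fun.
    exact: interval_open.
  move=> x; rewrite inE/= in_itv/= andbT; exact: continuous_expR_hyperbola.
rewrite (_ : (\int[_]_(_ in _) _)%E = (2 * Num.sqrt (b / a) *
    besselK 1 (2 * Num.sqrt (a * b)))%:E) ?ltry// -E.
by apply: eq_integral => x _ /=; rewrite ger0_norm ?expR_ge0.
Qed.

(** * Positivity of the exponential rates and regularity of [FY] and [fX] *)

(** Keeps the denominators of [coefR] and [coefU] positive up to the extreme correlations 0 and
    1. *)
Lemma convex_comb_gt0 (R : realType) (r a b : R) :
  0 <= r <= 1 -> 0 < a -> 0 < b -> 0 < r * a + (1 - r) * b.
Proof.
move=> /andP[]; rewrite le_eqVlt => /predU1P[<- _ _ b0|r0 r1 a0 b0].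
  by rewrite mul0r add0r subr0 mul1r.
by rewrite ltr_pwDl ?mulr_gt0// mulr_ge0 ?subr_ge0// ltW.
Qed.

Lemma gbar_gt0 (R : realType) (g1 g2 : R) : 0 < g1 -> 0 < g2 -> 0 < gbar g1 g2.
Proof. by move=> g10 g20; rewrite divr_gt0 ?mulr_gt0 ?addr_gt0. Qed.

Lemma coefR_gt0 (R : realType) (N k : nat) (g1 g2 r1 : R) (n j : nat) :
  0 < g1 -> 0 < g2 -> 0 <= r1 <= 1 -> 0 < coefR N k g1 g2 r1 n j.
Proof.
move=> g10 g20 r01; rewrite /coefR; case: ifP => // _.
rewrite divr_gt0 ?mulr_gt0// ?ltr0n ?addn1//.
by rewrite -mulrA convex_comb_gt0 ?gbar_gt0 ?mulr_gt0 ?ltr0n.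
Qed.

Lemma coefU_gt0 (R : realType) (N k : nat) (g1 g2 r2 : R) (m i : nat) :
  0 < g1 -> 0 < g2 -> 0 <= r2 <= 1 -> 0 < coefU N k g1 g2 r2 m i.
Proof.
move=> g10 g20 r01; rewrite /coefU; case: ifP => _; first exact: divr_gt0.
rewrite divr_gt0 ?mulr_gt0// ?ltr0n ?addn1//.
by rewrite -mulrA convex_comb_gt0 ?gbar_gt0 ?mulr_gt0 ?ltr0n.
Qed.

Lemma continuous_expR_decay (R : realType) (a g : R) :
  continuous (fun x => expR (- (a * x / g))).
Proof.
move=> x; apply: continuous_comp; last exact: continuous_expR.
apply: cvgN; apply: cvgM; last exact: cvg_cst.
by apply: cvgM; [exact: cvg_cst|exact: cvg_id].
Qed.

Lemma continuous_FY (R : realType) (N k : nat) (g1 g2 r2 : R) :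
  continuous (FY N k g1 g2 r2).
Proof.
move=> y; apply: cvgB; first exact: cvg_cst.
apply: cvgM; first exact: cvg_cst.
apply: cvg_big => [|m _]; first exact: add_continuous.
apply: cvg_big => [|i _]; first exact: add_continuous.
by apply: cvgM; [exact: cvg_cst|exact: continuous_expR_decay].
Qed.

Lemma measurable_fX (R : realType) (N k : nat) (g1 g2 r1 : R) :
  measurable_fun setT (fX N k g1 g2 r1).
Proof.
apply: measurable_fun_ifT => //; first exact: measurable_fun_ler.
apply: measurable_funM => //; apply: measurable_sum => n.
apply: measurable_sum => j; apply: measurable_funM => //.
by apply: continuous_measurable_fun; exact: continuous_expR_decay.
Qed.

Lemma double_sum_mul (R : realType) (k : nat) (A B : R) (f g : nat -> nat -> R) :
  (A * \sum_(0 <= m < k) \sum_(1 <= i < 3) f m i) *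
  (B * \sum_(0 <= n < k) \sum_(1 <= j < 3) g n j) =
  \sum_(0 <= m < k) \sum_(0 <= n < k) \sum_(1 <= i < 3) \sum_(1 <= j < 3)
    A * B * (f m i * g n j).
Proof.
rewrite mulrACA big_distrlr/= mulr_sumr; apply: eq_bigr => m _.
rewrite mulr_sumr; apply: eq_bigr => n _.
rewrite big_distrlr/= mulr_sumr; apply: eq_bigr => i _.
by rewrite mulr_sumr.
Qed.

(** * The outage probability as a single integral *)

Lemma sndr_outage_integral (d : measure_display) (Omega : measurableType d)
    (R : realType) (P : probability Omega R) (X Y : {RV P >-> R})
    (f F : R -> R) (zeta t : R) :
  0 < zeta -> 0 < t ->
  {ae P, forall w, 0 <= X w} -> {ae P, forall w, 0 <= Y w} ->
  independent_RV X Y -> has_density X f -> measurable_fun setT f ->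
  (forall y, 0 <= y -> cdf Y y = (F y)%:E) -> continuous F ->
  P [set w | sndr zeta (X w) (Y w) < t] =
  (1 - \int[lebesgue_measure]_(x in `](t * zeta)%R, +oo[)
     ((1 - F (t + zeta * t * (1 + t) / (x - t * zeta))) * f x)%:E)%E.
Proof.
move=> z0 t0 X0 Y0 XY Xf mf YF cF.
set c0 := t * zeta; set cc := zeta * t * (1 + t).
have cc0 : 0 < cc by rewrite !mulr_gt0// addr_gt0.
pose A := [set z : R * R | (c0 < z.1) && (cc <= (z.1 - c0) * (z.2 - t))].
have mA : measurable A.
  apply: measurable_fun_bool_set; apply: measurable_and.
    exact: measurable_fun_ltr.
  apply: measurable_fun_ler => //.
  by apply: measurable_funM; exact: measurable_funB.
have mSA : measurable [set w | A (X w, Y w)].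
  have mXY : measurable_fun setT (fun w => (X w, Y w)).
    exact: measurable_fun_pair.
  by rewrite -[X in measurable X]setTI; exact: mXY.
pose G x := distribution P Y (xsection A x).
(* For x > c0 the section of [A] is the half-line from t + cc / (x - c0), a positive point, so the
   CDF formula applies; otherwise it is empty. *)
have GE x : G x = if c0 < x then (1 - F (t + cc / (x - c0)))%:E else 0%E.
  rewrite /G; case: ifPn => [cx|ncx]; last first.
    rewrite (_ : xsection A x = set0) ?measure0//.
    apply/seteqP; split => // y /xsectionP/= /andP[cx _].
    by rewrite cx in ncx.
  have xc : 0 < x - c0 by rewrite subr_gt0.
  rewrite (_ : xsection A x = `[t + cc / (x - c0), +oo[%classic).
    apply: distribution_cy_cdf => //; last exact: cF.
    by rewrite addr_gt0// divr_gt0.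
  apply/seteqP; split => y.
    move=> /xsectionP/= /andP[_]; rewrite in_itv/= andbT -lerBrDl.
    by rewrite ler_pdivrMr// mulrC.
  rewrite /= in_itv/= andbT -lerBrDl ler_pdivrMr// mulrC => h.
  by apply/xsectionP; rewrite /A/= cx h.
have mG : measurable_fun setT G by exact: measurable_fun_xsection.
have iG : P.-integrable setT (G \o X).
  apply: (le_integrable _ _ _ (finite_measure_integrable_cst P 1 measurableT)).
  - exact: measurableT.
  - exact: measurableT_comp.
  - move=> w _; rewrite /G/= gee0_abs ?measure_ge0// normr1.
    by apply: probability_le1; exact: measurable_xsection.
(* The two events agree wherever X and Y are nonnegative, hence almost surely. *)
transitivity (P (~` [set w | A (X w, Y w)])).
  apply: ae_eq_measure_set; first exact: measurable_sndr_lt.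
    exact: measurableC.
  apply: filterS2 X0 Y0 => w Xw Yw /=.
  by rewrite sndr_ltE// /A/=; split => [/negP|/negP].
rewrite probability_setC//; congr (1 - _)%E.
rewrite independent_RV_joint// (integral_has_density Xf mf mG iG).
rewrite [RHS]integral_mkcond; apply: eq_integral => x _.
rewrite patchE GE; case: ifPn => [cx|ncx].
  by rewrite mem_set ?EFinM//= in_itv/= cx.
by rewrite mul0e memNset//= in_itv/= andbT; exact/negP.
Qed.

(** * Expansion into exponentials and evaluation by K_1 *)

Theorem mainTheorem2 (R : realType) (d : measure_display)
    (Omega : measurableType d) (P : probability Omega R)
    (N k : nat) (g1 g2 r1 r2 : R) (X Y : {RV P >-> R}) (zeta gth : R)
    (k_ge1 : (1 <= k)%N) (k_leN : (k <= N)%N)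
    (g1_gt0 : 0 < g1) (g2_gt0 : 0 < g2)
    (r1_01 : 0 <= r1 <= 1) (r2_01 : 0 <= r2 <= 1)
    (X_ge0 : {ae P, forall w, 0 <= X w})
    (Y_ge0 : {ae P, forall w, 0 <= Y w})
    (XY_indep : independent_RV X Y)
    (X_density : has_density X (fX N k g1 g2 r1))
    (Y_cdf : forall y : R, 0 <= y -> cdf Y y = (FY N k g1 g2 r2 y)%:E)
    (zeta_ge1 : 1 <= zeta) (gth_gt0 : 0 < gth) :
  P [set w | sndr zeta (X w) (Y w) < gth] =
  (1 - 2 * k%:R ^+ 2 / g1 * 'C(N, k)%:R ^+ 2 *
    \sum_(0 <= m < k) \sum_(0 <= n < k) \sum_(1 <= i < 3) \sum_(1 <= j < 3)
      coefS N k g1 g2 m * coefP N k g1 g2 n *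
      coefT N k g1 g2 m i * coefQ N k g1 g2 r1 n j *
      Num.sqrt (coefU N k g1 g2 r2 m i * zeta * gth * (1 + gth) /
                coefR N k g1 g2 r1 n j) *
      expR (- (gth / g1 *
               (coefU N k g1 g2 r2 m i + zeta * coefR N k g1 g2 r1 n j))) *
      besselK 1 (2 / g1 *
        Num.sqrt (coefU N k g1 g2 r2 m i * coefR N k g1 g2 r1 n j *
                  zeta * gth * (1 + gth))))%:E.
Proof.
have z0 : 0 < zeta by exact: lt_le_trans zeta_ge1.
rewrite (sndr_outage_integral z0 gth_gt0 X_ge0 Y_ge0 XY_indep X_density
  (measurable_fX _ _ _ _ _) Y_cdf (@continuous_FY _ _ _ _ _ _)).
rewrite EFinB; congr (1 - _)%E.
set c0 := gth * zeta; set cc := zeta * gth * (1 + gth).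
pose K : R := k%:R * 'C(N, k)%:R.
pose K' : R := k%:R / g1 * 'C(N, k)%:R.
pose U := coefU N k g1 g2 r2; pose Rc := coefR N k g1 g2 r1.
pose S := coefS N k g1 g2; pose T := coefT N k g1 g2.
pose Pc := coefP N k g1 g2; pose Q := coefQ N k g1 g2 r1.
have cc0 : 0 < cc by rewrite !mulr_gt0// addr_gt0.
have U0 m i : 0 < U m i by exact: coefU_gt0.
have R0 n j : 0 < Rc n j by exact: coefR_gt0.
(* With u = x - c0, the exponents U (gth + cc / u) / g1 and R (u + c0) / g1 add up to a u + b / u
   plus the constant gth (U + zeta R) / g1, which [W] absorbs. *)
pose a n j := Rc n j / g1.
pose b m i := U m i * cc / g1.
have a0 n j : 0 < a n j by rewrite divr_gt0.
have b0 m i : 0 < b m i by rewrite divr_gt0// mulr_gt0.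
pose W m n i j := K * K' * (S m * T m i * (Pc n * Q n j)) *
  expR (- (gth / g1 * (U m i + zeta * Rc n j))).
have integrandE x : c0 < x ->
    (1 - FY N k g1 g2 r2 (gth + cc / (x - c0))) * fX N k g1 g2 r1 x =
    \sum_(0 <= m < k) \sum_(0 <= n < k) \sum_(1 <= i < 3) \sum_(1 <= j < 3)
      W m n i j * expR (- (a n j * (x - c0) + b m i / (x - c0))).
  move=> cx; have xc : x - c0 != 0 by rewrite subr_eq0 gt_eqF.
  (* x > c0 >= 0 selects the exponential branch of [fX]. *)
  have x0 : 0 <= x by rewrite (le_trans _ (ltW cx))// mulr_ge0// ltW.
  rewrite /fX x0 /FY opprB addrCA subrr addr0 double_sum_mul.
  apply: eq_bigr => m _; apply: eq_bigr => n _; apply: eq_bigr => i _.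
  apply: eq_bigr => j _; rewrite -/K -/K' /W.
  rewrite [X in _ * X = _]mulrACA -expRD [LHS]mulrA -[RHS]mulrA -expRD.
  congr (_ * expR _).
  rewrite /a /b -/(U m i) -/(Rc n j).
  have g1n : g1 != 0 by rewrite gt_eqF.
  by rewrite /c0; field; rewrite -/c0 xc g1n.
transitivity (\int[lebesgue_measure]_(x in `]c0, +oo[)
    (\sum_(0 <= m < k) \sum_(0 <= n < k) \sum_(1 <= i < 3) \sum_(1 <= j < 3)
      W m n i j * expR (- (a n j * (x - c0) + b m i / (x - c0))))%:E)%E.
  apply: eq_integral => x; rewrite inE/= in_itv/= andbT => cx.
  by rewrite integrandE.
have [_ ->] : has_integral lebesgue_measure `]c0, +oo[ (fun x =>
   \sum_(0 <= m < k) \sum_(0 <= n < k) \sum_(1 <= i < 3) \sum_(1 <= j < 3)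
      W m n i j * expR (- (a n j * (x - c0) + b m i / (x - c0))))
   (\sum_(0 <= m < k) \sum_(0 <= n < k) \sum_(1 <= i < 3) \sum_(1 <= j < 3)
      W m n i j * (2 * Num.sqrt (b m i / a n j) *
        besselK 1 (2 * Num.sqrt (a n j * b m i)))).
  have mD : measurable (`]c0, +oo[%classic : set R) by exact: measurable_itv.
  apply: has_integral_sum => // m; apply: has_integral_sum => // n.
  apply: has_integral_sum => // i; apply: has_integral_sum => // j.
  by apply: has_integralZ => //; exact: has_integral_expR_besselK.
congr EFin; rewrite mulr_sumr; apply: eq_bigr => m _.
rewrite mulr_sumr; apply: eq_bigr => n _.
rewrite mulr_sumr; apply: eq_bigr => i _.
rewrite mulr_sumr; apply: eq_bigr => j _.
rewrite -/(U m i) -/(Rc n j) -/(S m) -/(T m i) -/(Pc n) -/(Q n j).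
have g1n : g1 != 0 by rewrite gt_eqF.
have Rn : Rc n j != 0 by rewrite gt_eqF.
(* In b / a the factor g1 cancels; in a b it appears as 1 / g1^2 and leaves the square root as 1 /
   g1. *)
have -> : b m i / a n j = U m i * zeta * gth * (1 + gth) / Rc n j.
  by rewrite /a /b /cc; field; rewrite Rn g1n.
have -> : 2 * Num.sqrt (a n j * b m i) =
    2 / g1 * Num.sqrt (U m i * Rc n j * zeta * gth * (1 + gth)).
  rewrite -mulrA; congr (_ * _).
  have -> : a n j * b m i =
      g1^-1 ^+ 2 * (U m i * Rc n j * zeta * gth * (1 + gth)).
    by rewrite /a /b /cc; field.
  by rewrite sqrtrM ?sqr_ge0// sqrtr_sqr ger0_norm// invr_ge0 ltW.
rewrite /W /K /K'; field.
exact: g1n.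
Qed.
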